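(* Let $(A,\mathfrak m)$ be a Noetherian local ring of dimension $d\ge 2$ with $A/\mathfrak m$ infinite. Assume that the associated graded ring $G_{\mathfrak m}(A)=\bigoplus_{n\ge 0}\mathfrak m^n/\mathfrak m^{n+1}$ is a domain. Then: (1) $\alpha(A)\ge 1$. (2) If $A$ is also a UFD, then $\alpha(A)=1$.
   Context: For a finitely generated $A$-module $M$, $\operatorname{Ass}^{(i)}_A(M)$ denotes the set of associated primes of $M$ of height $i$, and $\sharp$ denotes cardinality. For an $A$-regular element $x\in\mathfrak m^s\setminus\mathfrak m^{s+1}$ set $A_s(x)=\sharp\operatorname{Ass}^{(1)}_A(A/(x))$. Set $\alpha_A(s)=\sup\{A_s(x)\mid x\in\mathfrak m^s\setminus\mathfrak m^{s+1}\text{ is } A\text{-regular}\}$ and $\alpha(A)=\limsup_{s\to\infty}\alpha_A(s)/s$. *)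

(* Defs.v *)
From HB Require Import structures.
From mathcomp Require Import all_boot all_order all_algebra.
From mathcomp Require Import all_classical all_reals all_analysis.

Set Implicit Arguments.
Unset Strict Implicit.
Unset Printing Implicit Defensive.

Import GRing.Theory.

Local Open Scope classical_set_scope.
Local Open Scope ring_scope.
Local Open Scope quotient_scope.

Section Ideals.
Variable A : comUnitRingType.
Implicit Types (I J P S : set A).

Definition is_ideal I : Prop :=
  [/\ I 0, forall x y, I x -> I y -> I (x + y) & forall a x, I x -> I (a * x)].

Definition ideal_gen S : set A := smallest is_ideal S.

Definition ideal_mul I J : set A :=
  ideal_gen [set x * y | x in I & y in J].

(* The powers I^n, with I^0 = A. *)
Definition ideal_pow I n : set A := iter n (ideal_mul I) setT.

Definition prime_ideal P : Prop :=
  [/\ is_ideal P, ~ P 1 & forall x y, P (x * y) -> P x \/ P y].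

Definition maximal_ideal I : Prop :=
  [/\ is_ideal I, ~ I 1 & forall J, is_ideal J -> ~ J 1 -> I `<=` J -> J = I].

Definition noetherian : Prop :=
  forall I, is_ideal I -> exists s : seq A, I = ideal_gen [set` s].

Definition local_ring (m : set A) : Prop :=
  forall I, maximal_ideal I <-> I = m.

(* There is a chain P_0 < ... < P_n = P of prime ideals. *)
Definition prime_chain P n : Prop :=
  exists p : nat -> set A,
    [/\ forall i, (i <= n)%N -> prime_ideal (p i),
        forall i, (i < n)%N -> p i `<` p i.+1
      & p n = P].

Definition has_height P n : Prop :=
  prime_chain P n /\ forall k, prime_chain P k -> (k <= n)%N.

Definition has_krull_dim n : Prop :=
  (exists P, prime_chain P n) /\ forall P k, prime_chain P k -> (k <= n)%N.

End Ideals.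

Arguments noetherian : clear implicits.
Arguments has_krull_dim : clear implicits.

Section IdealFacts.
Variable A : comUnitRingType.
Implicit Types (I J S : set A).

Lemma ideal_gen_ideal S : is_ideal (ideal_gen S).
Proof.
split=> [J [[]//]|x y Ix Iy J JP|a x Ix J JP].
  by case: (JP) => -[_ h _] _; apply: h; [exact: Ix|exact: Iy].
by case: (JP) => -[_ _ h] _; apply: h; exact: Ix.
Qed.

Lemma ideal_gen_sub S J : is_ideal J -> S `<=` J -> ideal_gen S `<=` J.
Proof. by move=> iJ SJ; exact: smallest_sub. Qed.

Lemma ideal_pow_ideal I n : is_ideal (ideal_pow I n).
Proof. by case: n => [|n]; [split|exact: ideal_gen_ideal]. Qed.

Lemma ideal_pow_mul I i j x y :
  ideal_pow I i x -> ideal_pow I j y -> ideal_pow I (i + j) (x * y).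
Proof.
elim: i x y => [|i IH] x y Ix Iy.
  by case: (ideal_pow_ideal I j) => _ _; exact.
have [h0 hD hM] := ideal_pow_ideal I (i.+1 + j).
suff: ideal_pow I i.+1 `<=` [set x | ideal_pow I (i.+1 + j) (x * y)] by exact.
apply: ideal_gen_sub.
  split=> /= [|u v|a u]; first by rewrite mul0r.
    by rewrite mulrDl; exact: hD.
  by rewrite -mulrA; exact: hM.
move=> _ /= [u Iu [v Iv <-]]; rewrite -mulrA.
by apply: sub_gen_smallest; exists u => //; exists (v * y) => //; exact: IH.
Qed.

Lemma ideal_powS I n : ideal_pow I n.+1 `<=` ideal_pow I n.
Proof.
apply: ideal_gen_sub; first exact: ideal_pow_ideal.
by move=> _ [u _ [v Iv <-]]; case: (ideal_pow_ideal I n) => _ _; exact.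
Qed.

Lemma ideal_zmod_closed I : is_ideal I -> zmod_closed (mem I).
Proof.
case=> I0 ID IM; split=> [|x y]; first by rewrite inE.
by rewrite !inE => Ix Iy; rewrite -[y]mul1r -mulNr; apply/ID/IM.
Qed.

End IdealFacts.

(* quo S is the A-module A/(S), for (S) the ideal generated by S. *)
Section Quotient.
Variables (A : comUnitRingType) (S : set A).

Definition ideal_gen_mem : A -> bool := fun x => x \in ideal_gen S.

HB.instance Definition _ :=
  GRing.isZmodClosed.Build A ideal_gen_mem
    (ideal_zmod_closed (ideal_gen_ideal S)).

Definition ideal_gen_zmod : zmodClosed A :=
  GRing.ZmodClosed.clone A ideal_gen_mem _.

Definition quo : Type := Quotient.quot ideal_gen_zmod.

HB.instance Definition _ := GRing.Zmodule.on quo.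

Definition quo_pi (a : A) : quo := \pi_(Quotient.quot ideal_gen_zmod) a.

Definition quo_scale (a : A) (u : quo) : quo :=
  quo_pi (a * repr (u : Quotient.quot ideal_gen_zmod)).

Lemma quo_piP x y : quo_pi x = quo_pi y <-> ideal_gen S (x - y).
Proof.
split=> [/eqP|h]; [|apply/eqP]; rewrite /quo_pi -Quotient.idealrBE inE //.
Qed.

Lemma quo_piK u : quo_pi (repr (u : Quotient.quot ideal_gen_zmod)) = u.
Proof. exact: reprK. Qed.

Lemma quo_piD x y : quo_pi (x + y) = quo_pi x + quo_pi y.
Proof. exact: (raddfD (\pi_(Quotient.quot ideal_gen_zmod))). Qed.

Lemma quo_scale_pi a x : quo_scale a (quo_pi x) = quo_pi (a * x).
Proof.
apply/quo_piP; rewrite -mulrBr; have [_ _] := ideal_gen_ideal S; apply.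
by apply/quo_piP; rewrite quo_piK.
Qed.

Fact quo_scaleA a b v : quo_scale a (quo_scale b v) = quo_scale (a * b) v.
Proof. by rewrite -[v]quo_piK !quo_scale_pi mulrA. Qed.

Fact quo_scale1 : left_id 1 quo_scale.
Proof. by move=> v; rewrite -[v]quo_piK quo_scale_pi mul1r. Qed.

Fact quo_scaleDr : right_distributive quo_scale +%R.
Proof.
move=> a u v; rewrite -[u]quo_piK -[v]quo_piK -quo_piD !quo_scale_pi mulrDr.
exact: quo_piD.
Qed.

Fact quo_scaleDl v : {morph quo_scale^~ v : a b / a + b}.
Proof.
by move=> a b; rewrite -[v]quo_piK !quo_scale_pi mulrDl; exact: quo_piD.
Qed.

HB.instance Definition _ :=
  GRing.Zmodule_isLmodule.Build A quo
    quo_scaleA quo_scale1 quo_scaleDr quo_scaleDl.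

End Quotient.

(* The associated graded ring: elements are the finitely supported families
   (f_n)_n with f_n in I^n / I^(n+1). *)
Section AssociatedGraded.
Variables (A : comUnitRingType) (I : set A).

Definition ipow_mem n : A -> bool := fun x => x \in ideal_pow I n.

HB.instance Definition _ n :=
  GRing.isZmodClosed.Build A (ipow_mem n)
    (ideal_zmod_closed (ideal_pow_ideal I n)).

Definition ipow_type n : Type := {x : A | x \in ipow_mem n}.

HB.instance Definition _ n := SubChoice.on (ipow_type n).
HB.instance Definition _ n := [SubChoice_isSubZmodule of ipow_type n by <:].

Definition ipow_next n : ipow_type n -> bool :=
  fun u => val u \in ipow_mem n.+1.

Fact ipow_next_zmod n : zmod_closed (@ipow_next n).
Proof.
have [h0 hB] := ideal_zmod_closed (ideal_pow_ideal I n.+1).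
split=> [|u v]; rewrite !unfold_in /ipow_next ?raddf0 ?raddfB; first exact: h0.
exact: hB.
Qed.

HB.instance Definition _ n :=
  GRing.isZmodClosed.Build (ipow_type n) (@ipow_next n) (@ipow_next_zmod n).

Definition ipow_next_sub n : zmodClosed (ipow_type n) :=
  GRing.ZmodClosed.clone (ipow_type n) (@ipow_next n) _.

Definition gr_piece n := Quotient.quot (ipow_next_sub n).

(* The class of x in I^n / I^(n+1); junk unless x is in I^n. *)
Definition gr_cl n (x : A) : gr_piece n :=
  \pi_(gr_piece n) (insubd (0 : ipow_type n) x).

Definition gr_rep n (u : gr_piece n) : A := val (repr u : ipow_type n).

Record assoc_gr := AssocGr {
  gr_coef :> forall n, gr_piece n;
  gr_finite : exists N, forall n, (N <= n)%N -> gr_coef n = 0 }.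

HB.instance Definition _ := gen_eqMixin assoc_gr.
HB.instance Definition _ := gen_choiceMixin assoc_gr.

Lemma gr_ext (f g : assoc_gr) : (forall n, f n = g n) -> f = g.
Proof.
case: f g => [f hf] [g hg] /= fg; have E : f = g by exact: functional_extensionality_dep.
by case: _ / E in hg *; congr AssocGr; exact: Prop_irrelevance.
Qed.

Lemma gr_repP n (u : gr_piece n) : ideal_pow I n (gr_rep u).
Proof. by have := valP (repr u : ipow_type n); rewrite !inE. Qed.

Lemma gr_repK n (u : gr_piece n) : gr_cl n (gr_rep u) = u.
Proof. by rewrite /gr_cl /gr_rep valKd reprK. Qed.

Lemma gr_clP n x y : ideal_pow I n x -> ideal_pow I n y ->
  gr_cl n x = gr_cl n y <-> ideal_pow I n.+1 (x - y).
Proof.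
move=> Ix Iy; rewrite /gr_cl; set u := insubd _ x; set v := insubd _ y.
have eu : val u = x by rewrite insubdK //; exact: mem_set.
have ev : val v = y by rewrite insubdK //; exact: mem_set.
have E : (u - v \in @ipow_next n) = (x - y \in ideal_pow I n.+1).
  by rewrite unfold_in /ipow_next raddfB /= eu ev.
split=> [/eqP|h]; [|apply/eqP]; rewrite -Quotient.idealrBE E inE //.
Qed.

Lemma gr_clD n x y : ideal_pow I n x -> ideal_pow I n y ->
  gr_cl n (x + y) = gr_cl n x + gr_cl n y.
Proof.
move=> Ix Iy; rewrite /gr_cl -raddfD; congr (\pi _); apply: val_inj.
have [_ ID _] := ideal_pow_ideal I n.
by rewrite raddfD /= !insubdK //; apply: mem_set => //; exact: ID.
Qed.

Lemma gr_cl0 n : gr_cl n 0 = 0.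
Proof.
have [I0 _ _] := ideal_pow_ideal I n.
by apply: (addrI (gr_cl n 0)); rewrite -gr_clD // !addr0.
Qed.

Lemma gr_cl_sum n k (F : 'I_k -> A) : (forall i, ideal_pow I n (F i)) ->
  gr_cl n (\sum_i F i) = \sum_i gr_cl n (F i).
Proof.
have [I0 ID _] := ideal_pow_ideal I n.
move=> IF; suff [] : ideal_pow I n (\sum_i F i) /\
  gr_cl n (\sum_i F i) = \sum_i gr_cl n (F i) by [].
elim/big_rec2: _ => [|i u x _ [Ix <-]]; first by rewrite gr_cl0.
by split; [exact: ID|rewrite gr_clD].
Qed.

Lemma gr_rep_cl n x : ideal_pow I n x -> ideal_pow I n.+1 (gr_rep (gr_cl n x) - x).
Proof. by move=> Ix; apply/gr_clP => //; [exact: gr_repP|rewrite gr_repK]. Qed.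

(* The class of xy in I^(i+j) / I^(i+j+1) only depends on the classes of
   x in I^i / I^(i+1) and y in I^j / I^(j+1). *)
Lemma gr_cl_mul i j x y : ideal_pow I i x -> ideal_pow I j y ->
  gr_cl (i + j) (gr_rep (gr_cl i x) * gr_rep (gr_cl j y)) = gr_cl (i + j) (x * y).
Proof.
move=> Ix Iy; apply/gr_clP; try by apply: ideal_pow_mul => //; exact: gr_repP.
set x' := gr_rep _; set y' := gr_rep _.
have -> : x' * y' - x * y = (x' - x) * y' + x * (y' - y).
  by rewrite mulrBl mulrBr addrA subrK.
have [_ ID _] := ideal_pow_ideal I (i + j).+1; apply: ID.
  by rewrite -addSn; apply: ideal_pow_mul; [exact: gr_rep_cl|exact: gr_repP].
by rewrite -addnS; apply: ideal_pow_mul => //; exact: gr_rep_cl.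
Qed.

Fact gr_zero_finite : exists N, forall n, (N <= n)%N -> (0 : gr_piece n) = 0.
Proof. by exists 0%N. Qed.
Definition gr_zero := AssocGr gr_zero_finite.

Fact gr_one_finite : exists N, forall n, (N <= n)%N ->
  gr_cl n ((n == 0%N)%:R : A) = 0.
Proof. by exists 1%N => -[|n] // _; exact: gr_cl0. Qed.
Definition gr_one := AssocGr gr_one_finite.

Fact gr_opp_finite (f : assoc_gr) :
  exists N, forall n, (N <= n)%N -> - f n = 0.
Proof. by have [N h] := gr_finite f; exists N => n /h ->; rewrite oppr0. Qed.
Definition gr_opp f := AssocGr (gr_opp_finite f).

Fact gr_add_finite (f g : assoc_gr) :
  exists N, forall n, (N <= n)%N -> f n + g n = 0.
Proof.
have [N h] := gr_finite f; have [M k] := gr_finite g.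
by exists (maxn N M) => n; rewrite geq_max => /andP[/h -> /k ->]; rewrite addr0.
Qed.
Definition gr_add f g := AssocGr (gr_add_finite f g).

Definition gr_mul_coef (f g : assoc_gr) n : gr_piece n :=
  \sum_(i < n.+1) gr_cl n (gr_rep (f i) * gr_rep (g (n - i)%N)).

Definition adapted (p : {poly A}) : Prop := forall n, ideal_pow I n p`_n.

Lemma gr_poly (f : assoc_gr) :
  exists2 p, adapted p & forall n, f n = gr_cl n p`_n.
Proof.
have [N h] := gr_finite f; exists (\poly_(n < N) gr_rep (f n)) => n.
  rewrite coef_poly; case: ifP => _; first exact: gr_repP.
  by case: (ideal_pow_ideal I n).
rewrite coef_poly; case: ltnP => nN; first by rewrite gr_repK.
by rewrite h // gr_cl0.
Qed.

Lemma adapted_mul p q : adapted p -> adapted q -> adapted (p * q).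
Proof.
move=> hp hq n; rewrite coefM; have [I0 ID _] := ideal_pow_ideal I n.
elim/big_rec: _ => // i x _; apply: ID.
by rewrite -[X in ideal_pow I X](subnKC (ltn_ord i : (i <= n)%N)); exact: ideal_pow_mul.
Qed.

Lemma gr_mul_poly (f g : assoc_gr) p q : adapted p -> adapted q ->
  (forall n, f n = gr_cl n p`_n) -> (forall n, g n = gr_cl n q`_n) ->
  forall n, gr_mul_coef f g n = gr_cl n (p * q)`_n.
Proof.
move=> hp hq fp gq n; rewrite coefM gr_cl_sum; last first.
  move=> i; rewrite -[X in ideal_pow I X](subnKC (ltn_ord i : (i <= n)%N)).
  exact: ideal_pow_mul.
apply: eq_bigr => i _; rewrite fp gq.
have := gr_cl_mul (hp i) (hq (n - i)%N).
by rewrite (subnKC (ltn_ord i : (i <= n)%N)).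
Qed.

Fact gr_mul_finite (f g : assoc_gr) :
  exists N, forall n, (N <= n)%N -> gr_mul_coef f g n = 0.
Proof.
have [p hp fp] := gr_poly f; have [q hq gq] := gr_poly g.
exists (size (p * q)) => n hn.
by rewrite (gr_mul_poly hp hq fp gq) nth_default // gr_cl0.
Qed.
Definition gr_mul f g := AssocGr (gr_mul_finite f g).

Fact gr_addA : associative gr_add.
Proof. by move=> f g h; apply: gr_ext => n /=; rewrite addrA. Qed.
Fact gr_addC : commutative gr_add.
Proof. by move=> f g; apply: gr_ext => n /=; rewrite addrC. Qed.
Fact gr_add0 : left_id gr_zero gr_add.
Proof. by move=> f; apply: gr_ext => n /=; rewrite add0r. Qed.
Fact gr_addN : left_inverse gr_zero gr_opp gr_add.
Proof. by move=> f; apply: gr_ext => n /=; rewrite addNr. Qed.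

HB.instance Definition _ :=
  GRing.isZmodule.Build assoc_gr gr_addA gr_addC gr_add0 gr_addN.

Fact gr_mulA : associative gr_mul.
Proof.
move=> f g h; apply: gr_ext => n.
have [p hp fp] := gr_poly f; have [q hq gq] := gr_poly g.
have [r hr hr'] := gr_poly h.
have pq := adapted_mul hp hq; have qr := adapted_mul hq hr.
have fg k : gr_mul f g k = gr_cl k (p * q)`_k by exact: gr_mul_poly.
have gh k : gr_mul g h k = gr_cl k (q * r)`_k by exact: gr_mul_poly.
by rewrite /= (gr_mul_poly hp qr fp gh) (gr_mul_poly pq hr fg hr') mulrA.
Qed.

Fact gr_mulC : commutative gr_mul.
Proof.
move=> f g; apply: gr_ext => n.
have [p hp fp] := gr_poly f; have [q hq gq] := gr_poly g.
by rewrite /= (gr_mul_poly hp hq fp gq) (gr_mul_poly hq hp gq fp) mulrC.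
Qed.

Fact gr_mul1 : left_id gr_one gr_mul.
Proof.
move=> f; apply: gr_ext => n; have [p hp fp] := gr_poly f.
have h1 : adapted 1.
  by move=> [|k]; rewrite coef1 //; case: (ideal_pow_ideal I k.+1).
have e1 k : gr_one k = gr_cl k (1 : {poly A})`_k by rewrite coef1.
by rewrite /= (gr_mul_poly h1 hp e1 fp) mul1r -fp.
Qed.

Fact gr_mulDl : left_distributive gr_mul gr_add.
Proof.
move=> f g h; apply: gr_ext => n.
have [p hp fp] := gr_poly f; have [q hq gq] := gr_poly g.
have [r hr hr'] := gr_poly h.
have hpq : adapted (p + q).
  by move=> k; rewrite coefD; case: (ideal_pow_ideal I k) => _ ID _; exact: ID.
have epq k : gr_add f g k = gr_cl k (p + q)`_k by rewrite coefD gr_clD //= -fp -gq.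
rewrite /= (gr_mul_poly hpq hr epq hr') (gr_mul_poly hp hr fp hr').
rewrite (gr_mul_poly hq hr gq hr') mulrDl coefD gr_clD //; exact: adapted_mul.
Qed.

HB.instance Definition _ :=
  GRing.Zmodule_isComPzRing.Build assoc_gr gr_mulA gr_mulC gr_mul1 gr_mulDl.

End AssociatedGraded.

Definition is_domain (B : comPzRingType) : Prop :=
  (1 : B) <> 0 /\ forall x y : B, x * y = 0 -> x = 0 \/ y = 0.

Section UFD.
Variable A : comUnitRingType.

Definition irreducible_elt (x : A) : Prop :=
  [/\ x != 0, x \isn't a GRing.unit
    & forall a b, x = a * b -> a \is a GRing.unit \/ b \is a GRing.unit].

Definition associates (x y : A) : Prop :=
  exists2 u, u \is a GRing.unit & y = u * x.

Definition is_UFD : Prop :=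
  [/\ is_domain A,
      forall x : A, x != 0 -> x \isn't a GRing.unit ->
        exists2 s : seq A, {in s, forall p, irreducible_elt p}
                         & x = \prod_(p <- s) p
    & forall s t : seq A,
        {in s, forall p, irreducible_elt p} ->
        {in t, forall p, irreducible_elt p} ->
        \prod_(p <- s) p = \prod_(p <- t) p ->
        exists2 t', perm_eq t t' &
          size s = size t' /\
          forall i, (i < size s)%N -> associates s`_i t'`_i].

End UFD.

Arguments is_UFD : clear implicits.

Section Alpha.
Variable A : comUnitRingType.

Definition Ass (M : lmodType A) : set (set A) :=
  [set P | prime_ideal P /\ exists u : M, P = [set a | a *: u = 0]].

Definition Ass_ht (M : lmodType A) (i : nat) : set (set A) :=
  [set P | Ass M P /\ has_height P i].

Variables (R : realType) (m : set A).

(* counting is the cardinality, with value +oo on infinite sets. *)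
Definition Ass1_card (x : A) : \bar R := counting (Ass_ht (quo [set x]) 1).

(* GRing.lreg x: multiplication by x is injective on A.  The other half of
   regularity, A/(x) != 0, is automatic for x in m, hence for s > 0. *)
Definition alpha_at (s : nat) : \bar R :=
  ereal_sup [set Ass1_card x | x in
    [set x | [/\ ideal_pow m s x, ~ ideal_pow m s.+1 x & GRing.lreg x]]].

Definition alpha : \bar R :=
  limn_esup (fun s => alpha_at s * (s%:R^-1)%:E)%E.

End Alpha.

(* Main.v *)
Require Import Defs.
From HB Require Import structures.
From mathcomp Require Import all_boot all_order all_algebra.
From mathcomp Require Import all_classical all_reals all_analysis.
From mathcomp Require Import ring.

(* The graded ring being a domain makes the m-adic order additive, and with
   Krull's intersection theorem A is a domain.  For (1), pick x_1, x_2, ... in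
   m \ m^2 and primes P_i minimal over x_i, each x_{i+1} outside P_1, ..., P_i by
   prime avoidance (a in m \ m^2 can be corrected by an element of m^2).  The P_i
   have height one by Krull's principal ideal theorem, are associated to
   A/(x_1 ... x_s), and x_1 ... x_s has order exactly s.  For (2), an element of
   order s is a product of at most s irreducible elements p, and the height one
   primes containing it are among the (p). *)

Set Implicit Arguments.
Unset Strict Implicit.
Unset Printing Implicit Defensive.

Import Order.TTheory GRing.Theory Num.Theory.

Local Open Scope classical_set_scope.
Local Open Scope ring_scope.

(** * Ideals, adjunction of an element, colon ideals *)

Section CommutativeAlgebra.
Variable A : comUnitRingType.
Implicit Types (I J K P Q M : set A) (a b c x y z : A).

Lemma ideal0 I : is_ideal I -> I 0. Proof. by case. Qed.

Lemma idealD I x y : is_ideal I -> I x -> I y -> I (x + y).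
Proof. by case=> _ h _; exact: h. Qed.

Lemma ideal_mull I a x : is_ideal I -> I x -> I (a * x).
Proof. by case=> _ _; exact. Qed.

Lemma ideal_mulr I a x : is_ideal I -> I x -> I (x * a).
Proof. by rewrite mulrC; exact: ideal_mull. Qed.

Lemma idealN I x : is_ideal I -> I x -> I (- x).
Proof. by move=> hI Ix; rewrite -mulN1r; exact: ideal_mull. Qed.

Lemma idealB I x y : is_ideal I -> I x -> I y -> I (x - y).
Proof. by move=> hI Ix Iy; apply: idealD => //; exact: idealN. Qed.

Lemma ideal_addl I x y : is_ideal I -> I y -> I (x + y) -> I x.
Proof. by move=> hI Iy Ixy; rewrite -(addrK y x); exact: idealB. Qed.

Lemma ideal_addr I x y : is_ideal I -> I x -> I (x + y) -> I y.
Proof. by rewrite addrC; exact: ideal_addl. Qed.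

Lemma ideal_set0 : is_ideal [set (0 : A)].
Proof.
by split=> [//|x y /= -> ->|a x /= ->]; [rewrite addr0|rewrite mulr0].
Qed.

Lemma ideal_set_eqT I : is_ideal I -> I 1 -> I = setT.
Proof.
by move=> hI I1; apply/seteqP; split=> // x _; rewrite -[x]mulr1; exact: ideal_mull.
Qed.

Definition ideal_adjoin I c : set A :=
  [set z | exists2 i, I i & exists r, z = i + r * c].

Lemma ideal_adjoin_ideal I c : is_ideal I -> is_ideal (ideal_adjoin I c).
Proof.
move=> hI; split.
- by exists 0; [exact: ideal0|exists 0; rewrite mul0r addr0].
- move=> _ _ [i Ii [r ->]] [j Ij [t ->]]; exists (i + j); first exact: idealD.
  by exists (r + t); rewrite mulrDl addrACA.
- move=> a _ [i Ii [r ->]]; exists (a * i); first exact: ideal_mull.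
  by exists (a * r); rewrite mulrDr mulrA.
Qed.

Lemma sub_ideal_adjoin I c : I `<=` ideal_adjoin I c.
Proof. by move=> x Ix; exists x => //; exists 0; rewrite mul0r addr0. Qed.

Lemma ideal_adjoin_gen I c : is_ideal I -> ideal_adjoin I c c.
Proof. by move=> hI; exists 0; [exact: ideal0|exists 1; rewrite mul1r add0r]. Qed.

Lemma ideal_gen1P x z : ideal_gen [set x] z <-> exists r, z = r * x.
Proof.
split=> [|[r ->]].
  apply: (@ideal_gen_sub _ _ [set z | exists r, z = r * x]); last first.
    by move=> _ ->; exists 1; rewrite mul1r.
  split=> [|u v [r ->] [t ->]|a u [r ->]]; first by exists 0; rewrite mul0r.
    by exists (r + t); rewrite mulrDl.
  by exists (a * r); rewrite mulrA.
by apply: (@ideal_mull _ _ _ (ideal_gen_ideal _)); exact: sub_gen_smallest.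
Qed.

(** The annihilator of the class of [c] modulo [I]: associated primes are handled in this form. *)
Definition colon I c : set A := [set a | I (a * c)].

Lemma colon_ideal I c : is_ideal I -> is_ideal (colon I c).
Proof.
move=> hI; split=> [|x y hx hy|a x hx]; rewrite /colon /=.
- by rewrite mul0r; exact: ideal0.
- by rewrite mulrDl; exact: idealD.
- by rewrite -mulrA; exact: ideal_mull.
Qed.

Lemma sub_colon I c : is_ideal I -> I `<=` colon I c.
Proof. by move=> hI x Ix; exact: ideal_mulr. Qed.

(** * Noetherian rings *)

Lemma ascending_subset (f : nat -> set A) n k :
  (forall i, f i `<=` f i.+1) -> (n <= k)%N -> f n `<=` f k.
Proof.
move=> fS /subnK <-; elim: (k - n)%N => // j IH.
by apply: (subset_trans IH); exact: fS.
Qed.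

Lemma ascending_union_ideal (f : nat -> set A) :
  (forall n, is_ideal (f n)) -> (forall n, f n `<=` f n.+1) ->
  is_ideal (\bigcup_n f n).
Proof.
move=> hf fS; have mono n k := @ascending_subset f n k fS.
split=> [|x y [n _ fx] [k _ fy]|a x [n _ fx]].
- by exists 0%N => //; exact: ideal0.
- exists (maxn n k) => //; apply: idealD => //.
    by apply: mono fx; exact: leq_maxl.
  by apply: mono fy; exact: leq_maxr.
- by exists n => //; exact: ideal_mull.
Qed.

Hypothesis noethA : noetherian A.

(** The union of the chain is finitely generated, and its generators already lie in a single
    [f N]. *)
Lemma noetherian_acc (f : nat -> set A) :
  (forall n, is_ideal (f n)) -> (forall n, f n `<=` f n.+1) ->
  exists n, f n.+1 `<=` f n.
Proof.
move=> hf fS; have mono n k := @ascending_subset f n k fS.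
have [s hs] := noethA (ascending_union_ideal hf fS).
have [N hN] : exists N, [set` s] `<=` f N.
  have : [set` s] `<=` \bigcup_n f n by rewrite hs; exact: sub_gen_smallest.
  elim: s {hs} => [|x s IH] hs; first by exists 0%N.
  have [N hN] : exists N, [set` s] `<=` f N.
    by apply: IH => y /= ys; apply: hs; rewrite /= inE ys orbT.
  have [k _ fk] : (\bigcup_n f n) x by apply: hs; rewrite /= mem_head.
  exists (maxn k N) => y /=; rewrite inE => /predU1P[->|ys].
    by apply: mono fk; exact: leq_maxl.
  by apply: (mono N); [exact: leq_maxr|exact: hN].
exists N; apply: (@subset_trans _ (\bigcup_n f n)).
  by move=> x fx; exists N.+1.
by rewrite hs; exact: ideal_gen_sub.
Qed.

(** Otherwise choice builds a strictly increasing chain in [F] starting at [I0]. *)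
Lemma noetherian_max (F : set (set A)) I0 :
  (forall I, F I -> is_ideal I) -> F I0 ->
  exists I, [/\ F I, I0 `<=` I & forall J, F J -> I `<=` J -> J `<=` I].
Proof.
move=> hF FI0; apply: contrapT => nomax.
have step (I : {I | F I /\ I0 `<=` I}) :
    exists J : {J | F J /\ I0 `<=` J}, sval I `<` sval J.
  case: I => I [FI I0I] /=; apply: contrapT => noJ; apply: nomax.
  exists I; split=> // J FJ IJ; apply: contrapT => JI; apply: noJ.
  by exists (exist _ J (conj FJ (subset_trans I0I IJ))) => /=; split.
have [g hg] := choice step.
have F0 : F I0 /\ I0 `<=` I0 by split.
pose f n := sval (iter n g (exist _ I0 F0)).
have [|n|n] := @noetherian_acc f.
- by move=> n; apply: hF; rewrite /f; case: (iter _ _ _) => ? [].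
- by have [] := hg (iter n g (exist _ I0 F0)).
- by have [_ +] := hg (iter n g (exist _ I0 F0)); exact.
Qed.

Lemma noetherian_ind (Phi : set A -> Prop) :
  (forall I, is_ideal I ->
     (forall J, is_ideal J -> I `<` J -> Phi J) -> Phi I) ->
  forall I, is_ideal I -> Phi I.
Proof.
move=> step I hI; apply: contrapT => nI.
have [|J [[hJ nJ] _ Jmax]] :=
  @noetherian_max [set J | is_ideal J /\ ~ Phi J] I _ (conj hI nI).
  by move=> K [].
apply: (nJ); apply: step => // K hK [JK KJ]; apply: contrapT => nK.
by apply: KJ; exact: Jmax.
Qed.

(* Any (J : u) maximal among those contained in P is prime. *)
Lemma colon_prime J P : is_ideal J -> prime_ideal P -> J `<=` P ->
  exists2 u, prime_ideal (colon J u) & colon J u `<=` P.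
Proof.
move=> hJ [hP P1 Pprime] JP.
have [||I [[[u ->] uP] _ umax]] := @noetherian_max
  [set I | (exists u, I = colon J u) /\ I `<=` P] J.
- by move=> _ [[u ->] _]; exact: colon_ideal.
- by split=> //; exists 1; apply/seteqP; split=> x; rewrite /colon /= mulr1.
exists u => //; split; [exact: colon_ideal|by move=> /uP|].
move=> a b Jab.
(* If [colon J (a * u)] stays in [P], maximality makes it [colon J u], and it contains [b].
   Otherwise it has an element [c] outside [P]; then [colon J (c * u)] stays in [P], as [P] is
   prime, and contains [a]. *)
have [auP|] := pselect (colon J (a * u) `<=` P).
  right; apply: (umax (colon J (a * u))) => //; first by split=> //; exists (a * u).
    by move=> t ht; rewrite /colon /= mulrCA; exact: ideal_mull.
  by rewrite /colon /= mulrA [b * a]mulrC.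
move=> /existsNP [c /not_implyP [Jcau Pc]]; left.
apply: (umax (colon J (c * u))).
- split; first by exists (c * u).
  move=> t Jtcu; have : P (t * c) by apply: uP; rewrite /colon /= -mulrA.
  by case/Pprime.
- by move=> t ht; rewrite /colon /= mulrCA; exact: ideal_mull.
- by move: Jcau; rewrite /colon /= mulrCA.
Qed.

Definition minimal_over P x : Prop :=
  [/\ prime_ideal P, P x &
      forall Q, prime_ideal Q -> Q x -> Q `<=` P -> P `<=` Q].

(** A prime [colon J u] inside [P] contains [J], hence [x], so minimality makes it [P]. *)
Lemma minimal_over_colon P x J : is_ideal J -> minimal_over P x ->
  J x -> J `<=` P -> exists u, P = colon J u.
Proof.
move=> hJ [hP _ Pmin] Jx JP; have [u uprime uP] := colon_prime hJ hP JP.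
exists u; apply/seteqP; split=> //; apply: Pmin => //.
exact: sub_colon.
Qed.

(** * Krull's principal ideal theorem *)

(* The ideals saturated at P are those extended from the localization at P. *)
Definition sat P I : set A := [set a | exists2 s, ~ P s & I (s * a)].

Definition saturated P I : Prop := forall s a, ~ P s -> I (s * a) -> I a.

Section Saturation.
Variable P : set A.
Hypothesis P_prime : prime_ideal P.

Lemma prime_mulN s t : ~ P s -> ~ P t -> ~ P (s * t).
Proof. by case: P_prime => _ _ h Ps Pt /h []. Qed.

Lemma sat_ideal I : is_ideal I -> is_ideal (sat P I).
Proof.
move=> hI; split.
- by exists 1; [case: P_prime|rewrite mul1r; exact: ideal0].
- move=> x y [s Ps Ix] [t Pt Iy]; exists (s * t); first exact: prime_mulN.
  rewrite mulrDr; apply: idealD => //; first by rewrite mulrAC; exact: ideal_mulr.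
  by rewrite -mulrA; exact: ideal_mull.
- by move=> a x [s Ps Ix]; exists s => //; rewrite mulrCA; exact: ideal_mull.
Qed.

Lemma sat_saturated I : saturated P (sat P I).
Proof.
move=> s a Ps [t Pt It]; exists (t * s); first exact: prime_mulN.
by rewrite -mulrA.
Qed.

Lemma sub_sat I : is_ideal I -> I `<=` sat P I.
Proof. by move=> hI x Ix; exists 1; [case: P_prime|rewrite mul1r]. Qed.

Lemma sat_subset I J : I `<=` J -> sat P I `<=` sat P J.
Proof. by move=> IJ x [s Ps Ix]; exists s => //; exact: IJ. Qed.

Lemma sat_min I J : I `<=` J -> saturated P J -> sat P I `<=` J.
Proof. by move=> IJ hJ x [s Ps Ix]; apply: (hJ s) => //; exact: IJ. Qed.

Lemma saturated_proper I : is_ideal I -> saturated P I -> ~ I 1 -> I `<=` P.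
Proof.
move=> hI sI I1 x Ix; apply: contrapT => Px; apply: I1.
by apply: (sI x) => //; rewrite mulr1.
Qed.

Lemma sat_adjoin_ideal I c : is_ideal I -> is_ideal (sat P (ideal_adjoin I c)).
Proof. by move=> hI; exact/sat_ideal/ideal_adjoin_ideal. Qed.

Lemma sub_sat_adjoin I c : is_ideal I -> I `<=` sat P (ideal_adjoin I c).
Proof.
move=> hI; apply: subset_trans (sub_sat (ideal_adjoin_ideal c hI)).
exact: sub_ideal_adjoin.
Qed.

Lemma sat_adjoin_gen I c : is_ideal I -> sat P (ideal_adjoin I c) c.
Proof.
by move=> hI; apply: sub_sat; [exact: ideal_adjoin_ideal|exact: ideal_adjoin_gen].
Qed.

Lemma sat_adjoin_subset I J c :
  I `<=` J -> sat P (ideal_adjoin I c) `<=` sat P (ideal_adjoin J c).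
Proof.
move=> IJ; apply: sat_subset => _ [i Ii [r ->]].
by exists i; [exact: IJ|exists r].
Qed.

(** Nakayama's lemma in the localization at [P], where the hypothesis says that [M] lies in K + xM.
    Taking [J] maximal among the saturated ideals above [K] that do not contain [M] makes [M]
    locally cyclic modulo [J]. *)
Lemma nakayama_saturated K M x : is_ideal K -> is_ideal M ->
  saturated P K -> saturated P M -> P x ->
  (forall a, M a -> exists2 s, ~ P s & exists k b, [/\ K k, M b & s * a = k + b * x]) ->
  M `<=` K.
Proof.
move=> hK hM sK sM Px MKx; apply: contrapT => MK.
have [||J [[hJ sJ MJ] KJ Jmax]] := @noetherian_max
  [set J | [/\ is_ideal J, saturated P J & ~ M `<=` J]] K.
- by move=> J [].
- by [].
have /existsNP [z /not_implyP [Mz Jz]] := MJ.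
have Mcyc : M `<=` sat P (ideal_adjoin J z).
  apply: contrapT => Mn; apply: Jz.
  apply: (Jmax (sat P (ideal_adjoin J z))).
  - by split=> //; [exact: sat_adjoin_ideal|exact: sat_saturated].
  - exact: sub_sat_adjoin.
  - exact: sat_adjoin_gen.
have [s Ps [k [b [Kk Mb sz]]]] := MKx z Mz.
have [t Pt [j Jj [r tb]]] := Mcyc b Mb.
(* This factor is outside [P], since [t * s] is outside and [r * x] inside. *)
apply: Jz; apply: (sJ (t * s - r * x)).
  have [hP _ _] := P_prime.
  move=> /(ideal_addl hP (idealN hP (ideal_mull r hP Px))).
  exact: prime_mulN.
have -> : (t * s - r * x) * z = t * k + x * j.
  transitivity (t * k + t * b * x - x * (r * z)); last by rewrite tb; ring.
  by transitivity (t * (s * z) - x * (r * z)); [ring|rewrite sz; ring].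
by apply: idealD => //; apply: ideal_mull => //; exact: KJ.
Qed.

(* The localization at a minimal prime of (x) is artinian modulo x. *)
Lemma saturated_dcc x (I : nat -> set A) : minimal_over P x ->
  (forall n, is_ideal (I n)) -> (forall n, saturated P (I n)) ->
  (forall n, I n x) -> (forall n, I n.+1 `<=` I n) ->
  exists N, forall n, (N <= n)%N -> I N `<=` I n.
Proof.
move=> Pmin hI sI Ix Idec.
(* Noetherian induction on a common lower bound [J] of the chain; the result is then applied to the
   intersection of the chain. *)
pose Phi J := saturated P J -> J x -> forall I : nat -> set A,
  (forall n, is_ideal (I n)) -> (forall n, saturated P (I n)) ->
  (forall n, J `<=` I n) -> (forall n, I n.+1 `<=` I n) ->
  exists N, forall n, (N <= n)%N -> I N `<=` I n.
suff H : forall J, is_ideal J -> Phi J.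
  have hJ : is_ideal (\bigcap_n I n).
    split=> [n _|a b ha hb n _|a b hb n _]; first exact: ideal0.
      by apply: idealD; [|exact: ha|exact: hb].
    by apply: ideal_mull; [|exact: hb].
  apply: (H _ hJ) => // [s a Ps Ia n _|n]; last exact: bigcap_inf.
  by apply: (sI n s) => //; exact: Ia.
apply: noetherian_ind => J hJ IH sJ Jx {hI sI Ix Idec}I hI sI JI Idec.
have mono n k : (n <= k)%N -> I k `<=` I n.
  move=> /subnK <-; elim: (k - n)%N => // j jIH.
  by apply: subset_trans jIH; exact: Idec.
have [J1|J1] := pselect (J 1).
  by exists 0%N => n _ a _; rewrite (ideal_set_eqT (hI n) (JI n _ J1)).
have JP := saturated_proper hJ sJ J1.
(* Modulo [J] the annihilator of [c] is [P], so [c] spans a simple module locally at [P]. *)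
have [c Pc] := minimal_over_colon hJ Pmin Jx JP.
have Jc : ~ J c.
  by case: P_prime => _ P1 _ Jc; apply: P1; rewrite Pc /colon /= mul1r.
have hJc := sat_adjoin_ideal c hJ.
have JJc : J `<` sat P (ideal_adjoin J c).
  split; first exact: sub_sat_adjoin.
  by move=> /(_ c) h; apply: Jc; apply: h; exact: sat_adjoin_gen.
have Jcx : sat P (ideal_adjoin J c) x by exact: sub_sat_adjoin.
(* If every term contains [c], the lower bound [J] can be enlarged by [c]. Otherwise some [I k]
   misses [c], and the induction hypothesis is applied to the chain with [c] adjoined. *)
have [Ic|/existsNP [k Ikc]] := pselect (forall n, I n c).
  apply: (IH _ hJc JJc _ Jcx) => // [|n]; first exact: sat_saturated.
  apply: sat_min => // _ [j Jj [r ->]].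
  by apply: idealD => //; [exact: (JI n)|exact: ideal_mull].
have [|n|n|n|n|N hN] := IH _ hJc JJc _ Jcx
  (fun n => sat P (ideal_adjoin (I n) c)).
- exact: sat_saturated.
- exact: sat_adjoin_ideal.
- exact: sat_saturated.
- exact: sat_adjoin_subset.
- exact: sat_adjoin_subset.
exists (maxn N k) => n; rewrite geq_max => /andP[Nn kn] a Ia.
have [s Ps [i Ii [r sa]]] : sat P (ideal_adjoin (I n) c) a.
  apply: (hN n Nn); apply: sub_sat_adjoin => //.
  by apply: mono Ia; exact: leq_maxl.
apply: (sI n s) => //; rewrite sa; apply: idealD => //; apply: (JI n).
(* For [r] outside [P], saturation would put [c] in [I k]. Hence [r] is in [P], and [r * c] falls in
   [J]. *)
suff : P r by rewrite Pc.
apply: contrapT => Pr; apply: Ikc; apply: (sI k r) => //.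
have -> : r * c = s * a - i by rewrite sa [i + _]addrC addrK.
apply: idealB => //; last exact: mono Ii.
by apply: ideal_mull => //; apply: mono Ia; exact: leq_maxr.
Qed.

End Saturation.

Lemma domain_mulIf x y z : is_domain A -> z != 0 -> x * z = y * z -> x = y.
Proof.
move=> dA z0 /eqP; rewrite -subr_eq0 -mulrBl => /eqP /dA.2 [/eqP|/eqP].
  by rewrite subr_eq0 => /eqP.
by rewrite (negbTE z0).
Qed.

Lemma domain_expf_neq0 y n : is_domain A -> y != 0 -> y ^+ n != 0.
Proof.
move=> dA y0; elim: n => [|n IH]; first by rewrite expr0 oner_neq0.
apply/eqP; rewrite exprS => /dA.2 [] /eqP; first by rewrite (negbTE y0).
by rewrite (negbTE IH).
Qed.

(* For y in Q nonzero, put J_n = y^n A_Q cap A.  The chain J_n + (x) becomes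
   stationary locally at P; as x is regular modulo J_n, this gives
   J_n = J_{n+1} + x J_n and then J_n = J_{n+1} by Nakayama, which forces y to
   be a unit of A_Q. *)
Lemma krull_principal P Q x : is_domain A -> minimal_over P x ->
  prime_ideal Q -> Q `<` P -> Q = [set 0].
Proof.
move=> dA Pmin Qprime [QP PQ]; have [Pprime Px Pm] := Pmin.
have [hP _ _] := Pprime; have [hQ Q1 Qmul] := Qprime.
have Qx : ~ Q x by move=> Qx; apply: PQ; exact: Pm.
apply/seteqP; split=> [y Qy|_ ->]; last exact: ideal0.
apply: contrapT => /eqP y0.
pose J n := sat Q (ideal_gen [set y ^+ n]).
have hJ n : is_ideal (J n) by apply: sat_ideal => //; exact: ideal_gen_ideal.
have JsQ n : saturated Q (J n) by exact: sat_saturated.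
have JsP n : saturated P (J n).
  by move=> s a Ps; apply: JsQ => /QP.
have Jdec n : J n.+1 `<=` J n.
  apply: sat_subset => z /ideal_gen1P [r ->]; apply/ideal_gen1P.
  by exists (r * y); rewrite exprS mulrA.
pose I n := sat P (ideal_adjoin (J n) x).
have [n|n|n|n|N hN] := @saturated_dcc P Pprime x I Pmin.
- exact: sat_adjoin_ideal.
- exact: sat_saturated.
- exact: sat_adjoin_gen.
- exact: sat_adjoin_subset.
have JN : J N `<=` J N.+1.
  apply: (@nakayama_saturated P Pprime _ _ x) => // a Ja.
  have [s Ps [j Jj [r sa]]] : I N.+1 a.
    by apply: (hN N.+1) => //; exact: sub_sat_adjoin.
  exists s => //; exists j, r; split=> //.
  (* Regularity of [x] modulo [J N]: this ideal is saturated at [Q], and [x] is outside [Q]. *)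
  apply: (JsQ N x) => //; rewrite mulrC.
  have -> : r * x = s * a - j by rewrite sa [j + _]addrC addrK.
  by apply: idealB => //; [exact: ideal_mull|exact: Jdec].
(* Cancelling [y ^+ N] will leave [s] as a multiple of [y], hence in [Q]. *)
have [s Qs /ideal_gen1P [r]] : J N.+1 (y ^+ N).
  apply: JN; apply: sub_sat => //; first exact: ideal_gen_ideal.
  exact: sub_gen_smallest.
rewrite exprS mulrA => /(domain_mulIf dA (domain_expf_neq0 N dA y0)) sry.
by apply: Qs; rewrite sry; exact: ideal_mull.
Qed.

End CommutativeAlgebra.

(** * The associated graded ring of a local ring *)

Section IdealPowers.
Variable A : comUnitRingType.
Implicit Types (I J m P : set A) (x y : A).

Lemma ideal_pow_0 I n : ideal_pow I n 0.
Proof. by case: (ideal_pow_ideal I n). Qed.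

Lemma notin_ideal_pow_neq0 I n x : ~ ideal_pow I n x -> x != 0.
Proof. by move=> nx; apply/eqP => x0; apply: nx; rewrite x0; exact: ideal_pow_0. Qed.

Lemma ideal_pow1 I : is_ideal I -> ideal_pow I 1 = I.
Proof.
move=> hI; apply/seteqP; split=> [|x Ix].
  apply: ideal_gen_sub => // _ [x Ix [y _ <-]]. exact: ideal_mulr.
by apply: sub_gen_smallest; exists x => //; exists 1 => //; rewrite mulr1.
Qed.

Lemma ideal_pow_le I n k : (n <= k)%N -> ideal_pow I k `<=` ideal_pow I n.
Proof.
move=> /subnK <-; elim: (k - n)%N => // j IH.
by apply: subset_trans IH; exact: ideal_powS.
Qed.

Lemma ideal_pow_expn I x n : is_ideal I -> I x -> ideal_pow I n (x ^+ n).
Proof.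
move=> hI Ix; elim: n => // n IH; rewrite exprS -add1n.
by apply: ideal_pow_mul => //; rewrite ideal_pow1.
Qed.

Lemma prime_ideal_expn P x n : prime_ideal P -> P (x ^+ n) -> P x.
Proof.
by case=> _ P1 PM; elim: n => [//|n IH]; rewrite exprS => /PM [].
Qed.

Lemma prime_ideal_prod P (s : seq A) :
  prime_ideal P -> P (\prod_(p <- s) p) -> exists2 p, p \in s & P p.
Proof.
case=> _ P1 PM; elim: s => [|p s IH]; rewrite ?big_nil // big_cons.
case/PM => [Pp|/IH [q qs Pq]]; first by exists p => //; rewrite mem_head.
by exists q => //; rewrite inE qs orbT.
Qed.

Lemma ideal_pow_prod I (s : seq A) :
  is_ideal I -> {in s, forall p, I p} -> ideal_pow I (size s) (\prod_(p <- s) p).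
Proof.
move=> hI; elim: s => [|p s IH] hs; rewrite ?big_nil ?big_cons //=.
apply: (@ideal_pow_mul _ _ 1).
  by rewrite ideal_pow1 //; apply: hs; rewrite mem_head.
by apply: IH => q qs; apply: hs; rewrite inE qs orbT.
Qed.

End IdealPowers.

(** * Additivity of the m-adic order *)

Section AssociatedGradedDomain.
Variables (A : comUnitRingType) (m : set A).

Fact gr_of_poly_finite (p : {poly A}) :
  exists N, forall n, (N <= n)%N -> gr_cl m n p`_n = 0.
Proof. by exists (size p) => n hn; rewrite nth_default // gr_cl0. Qed.

Definition gr_of_poly p : assoc_gr m := AssocGr (gr_of_poly_finite p).

(** The homogeneous elements given by [x] in degree [i] and [y] in degree [j] are nonzero, and their
    product is the class of [x * y] in degree [i + j]. Monomials represent them. *)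
Lemma gr_domain_mul_notin i j x y : is_domain (assoc_gr m) ->
  ideal_pow m i x -> ~ ideal_pow m i.+1 x ->
  ideal_pow m j y -> ~ ideal_pow m j.+1 y ->
  ~ ideal_pow m (i + j).+1 (x * y).
Proof.
move=> [_ domG] ix nix jy njy ijxy.
have hmono k z : ideal_pow m k z -> adapted m (z *: 'X^k).
  move=> kz n; rewrite coefZ coefXn; case: eqVneq => [->|_]; first by rewrite mulr1.
  by rewrite mulr0; exact: ideal_pow_0.
have hnz k z : ideal_pow m k z -> gr_of_poly (z *: 'X^k) = 0 -> ideal_pow m k.+1 z.
  move=> kz /(congr1 (fun f : assoc_gr m => f k)) /=.
  rewrite coefZ coefXn eqxx mulr1 -[RHS](gr_cl0 m k) => /gr_clP.
  by rewrite subr0; apply=> //; exact: ideal_pow_0.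
have [|/hnz|/hnz] := domG (gr_of_poly (x *: 'X^i)) (gr_of_poly (y *: 'X^j)).
- apply: gr_ext => n; rewrite /= (gr_mul_poly (hmono _ _ ix) (hmono _ _ jy)) //.
  rewrite -scalerAl -scalerAr -exprD scalerA coefZ coefXn.
  case: eqVneq => [->|_]; last by rewrite mulr0 gr_cl0.
  rewrite mulr1 -[RHS](gr_cl0 m (i + j)); apply/gr_clP; rewrite ?subr0 //.
    exact: ideal_pow_mul.
  exact: ideal_pow_0.
- by move=> /(_ ix).
- by move=> /(_ jy).
Qed.

End AssociatedGradedDomain.

(** * Local rings and Krull's intersection theorem *)

Section LocalRing.
Variables (A : comUnitRingType) (m : set A).
Hypotheses (noethA : noetherian A) (localA : local_ring m).
Implicit Types (I J P Q : set A) (x y : A).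

Lemma maximal_m : maximal_ideal m. Proof. exact/localA. Qed.

Lemma m_ideal : is_ideal m. Proof. by case: maximal_m. Qed.

Lemma proper_ideal_sub I : is_ideal I -> ~ I 1 -> I `<=` m.
Proof.
move=> hI I1.
have [|J [[hJ J1] IJ Jmax]] :=
  @noetherian_max _ noethA [set J | is_ideal J /\ ~ J 1] I _ (conj hI I1).
  by move=> J [].
suff /localA <- : maximal_ideal J by [].
split=> // K hK K1 JK; apply/seteqP; split=> //.
by apply: Jmax => //; split.
Qed.

Lemma notin_m_unit x : ~ m x -> x \is a GRing.unit.
Proof.
move=> mx; suff : ideal_gen [set x] 1.
  by move=> /ideal_gen1P [r r1]; apply/unitrPr; exists r; rewrite mulrC.
apply: contrapT => n1; apply: mx.
apply: (proper_ideal_sub (ideal_gen_ideal [set x])) => //.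
exact: sub_gen_smallest.
Qed.

Lemma m_nonunit x : m x -> x \isn't a GRing.unit.
Proof.
move=> mx; apply/negP => xu; have [_ + _] := maximal_m; apply.
by rewrite -(mulVr xu); apply: ideal_mull => //; exact: m_ideal.
Qed.

Lemma m_prime : prime_ideal m.
Proof.
have [hm m1 _] := maximal_m; split=> // x y mxy.
apply: contrapT => /not_orP [/notin_m_unit xu /notin_m_unit yu].
by have := m_nonunit mxy; rewrite unitrM xu yu.
Qed.

Lemma prime_sub_m P : prime_ideal P -> P `<=` m.
Proof. by case=> hP P1 _; exact: proper_ideal_sub. Qed.

(** Noetherian induction. Some prime [colon J u] contains a power of each element of [m], hence
    contains [m]. So [m] multiplies [u] into [J], and one more factor of [m] brings a power lying in
    J + (u) into [J]. *)
Lemma nilpotent_pow_sub J : is_ideal J ->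
  (forall a, m a -> exists n, J (a ^+ n)) -> exists k, ideal_pow m k `<=` J.
Proof.
move: J; apply: (noetherian_ind noethA) => J hJ IH nilJ.
have [J1|J1] := pselect (J 1); first by exists 0%N; rewrite (ideal_set_eqT hJ J1).
have Jm := proper_ideal_sub hJ J1.
have [u uprime _] := colon_prime noethA hJ m_prime Jm.
have mu a : m a -> J (a * u).
  move=> /nilJ [n Jan]; apply: (@prime_ideal_expn _ _ _ n uprime).
  exact: sub_colon.
have Ju : ~ J u.
  by case: uprime => _ + _ Ju; rewrite /colon /= mul1r.
have [|a /nilJ [n Jan]|k kJ] := IH _ (ideal_adjoin_ideal u hJ).
- split; first exact: sub_ideal_adjoin.
  by move=> /(_ u) h; apply: Ju; apply: h; exact: ideal_adjoin_gen.
- by exists n; exact: sub_ideal_adjoin.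
- exists k.+1; apply: ideal_gen_sub => // _ [a ma [b /kJ [j Jj [r ->]] <-]].
  rewrite mulrDr mulrCA; apply: idealD => //; apply: ideal_mull => //.
  exact: mu.
Qed.

(* An ideal J maximal among those containing xm but not x contains a power of
   every element of m, hence a power of m. *)
Lemma krull_intersection x : (forall n, ideal_pow m n x) -> x = 0.
Proof.
move=> xpow; apply: contrapT => x0; have hm := m_ideal.
have [||J [[hJ xmJ Jx] _ Jmax]] := @noetherian_max _ noethA
  [set J | [/\ is_ideal J, forall a, m a -> J (a * x) & ~ J x]]
  [set a * x | a in m].
- by move=> J [].
- split.
  + split=> [|_ _ [a ma <-] [b mb <-]|c _ [a ma <-]].
    * by exists 0; [exact: ideal0|rewrite mul0r].
    * by exists (a + b); [exact: idealD|rewrite mulrDl].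
    * by exists (c * a); [exact: ideal_mull|rewrite mulrA].
  + by move=> a ma; exists a.
  (* If [a * x = x] with [a] in [m], the unit [1 - a] kills [x]. *)
  + move=> [a ma ax]; apply: x0.
    have u : 1 - a \is a GRing.unit.
      apply: notin_m_unit => m1a; have [_ + _] := maximal_m; apply.
      by rewrite -(subrK a 1); exact: idealD.
    by apply: (mulrI u); rewrite mulr0 mulrBl mul1r ax subrr.
have nil a : m a -> exists n, J (a ^+ n).
  (* Let the chain [colon J (a ^+ n)] stop at [n]. If [x = j + r * a ^+ n], then [a * x] in [J]
     gives [r * a ^+ n.+1] in [J], hence [r * a ^+ n] and [x] in [J]. So adjoining [a ^+ n] keeps
     [x] out, and maximality puts [a ^+ n] in [J]. *)
  move=> ma; have [||n hn] := @noetherian_acc _ noethA (fun n => colon J (a ^+ n)).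
  - by move=> n; exact: colon_ideal.
  - by move=> n t; rewrite /colon /= exprSr mulrA => ht; exact: ideal_mulr.
  exists n; apply: (Jmax (ideal_adjoin J (a ^+ n))).
  - split; first exact: ideal_adjoin_ideal.
      by move=> b mb; apply: sub_ideal_adjoin; exact: xmJ.
    move=> [j Jj [r xE]]; apply: Jx; rewrite xE; apply: idealD => //.
    apply: hn; rewrite /colon /= exprS mulrCA.
    have -> : a * (r * a ^+ n) = a * x - a * j by rewrite xE; ring.
    by apply: idealB => //; [exact: xmJ|exact: ideal_mull].
  - exact: sub_ideal_adjoin.
  - exact: ideal_adjoin_gen.
have [k kJ] := nilpotent_pow_sub hJ nil.
by apply: Jx; exact: kJ.
Qed.

Lemma order_exists x : x <> 0 ->
  exists i, ideal_pow m i x /\ ~ ideal_pow m i.+1 x.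
Proof.
move=> x0; apply: contrapT => nx; apply: x0; apply: krull_intersection.
elim=> [//|n IH]; apply: contrapT => nn; apply: nx; exists n; split=> //.
Qed.

(** Nonzero elements have finite order by Krull's intersection theorem, and orders add. *)
Lemma gr_domain_domain : is_domain (assoc_gr m) -> is_domain A.
Proof.
move=> domG; split=> [|x y xy]; first by apply/eqP; exact: oner_neq0.
apply: contrapT => /not_orP [/order_exists [i [ix nix]]].
move=> /order_exists [j [jy njy]].
apply: (gr_domain_mul_notin domG ix nix jy njy); rewrite xy.
exact: ideal_pow_0.
Qed.

End LocalRing.

(** * Primes of height one *)

Section AssociatedPrimesOfQuotient.
Variable A : comUnitRingType.
Implicit Types (P : set A) (x : A).

Lemma quo_pi_eq0 (S : set A) x : quo_pi S x = 0 <-> ideal_gen S x.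
Proof.
have <- : quo_pi S 0 = 0.
  by apply: (addrI (quo_pi S 0)); rewrite -quo_piD !addr0.
by rewrite quo_piP subr0.
Qed.

Lemma AssP (S : set A) P : Ass (quo S) P <->
  prime_ideal P /\ exists u, P = colon (ideal_gen S) u.
Proof.
have annE u : [set a | a *: quo_pi S u = 0] = colon (ideal_gen S) u.
  by apply/seteqP; split=> a; rewrite /= [_ *: _]quo_scale_pi => /quo_pi_eq0.
split=> -[hP [u PE]]; split=> //.
  by exists (repr (u : Quotient.quot _)); rewrite PE -{1}(quo_piK u) annE.
by exists (quo_pi S u); rewrite annE.
Qed.

End AssociatedPrimesOfQuotient.

(** * Height one primes in a domain and prime avoidance *)

Section HeightOne.
Variable A : comUnitRingType.
Implicit Types (P Q : set A) (x y : A) (s : seq (set A)).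

Lemma prime_chain_extend Q P n :
  prime_chain Q n -> Q `<` P -> prime_ideal P -> prime_chain P n.+1.
Proof.
move=> [p [pprime pinc pn]] QP hP.
exists (fun i => if (i <= n)%N then p i else P); split=> [i _|i|].
- by case: leqP => // /pprime.
- rewrite ltnS => hi; rewrite hi; move: hi.
  rewrite leq_eqVlt => /predU1P[->|ilt]; first by rewrite ltnn pn.
  by rewrite ilt; exact: pinc.
- by rewrite ltnn.
Qed.

(** Without a minimal prime over [x], every prime containing [x] would end chains of any length,
    against finite dimension. *)
Lemma minimal_over_exists d P x : has_krull_dim A d -> prime_ideal P -> P x ->
  exists Q, minimal_over Q x.
Proof.
move=> [_ dmax] hP Px; apply: contrapT => nomin.
have chain n Q : prime_ideal Q -> Q x -> prime_chain Q n.
  elim: n Q => [|n IH] Q hQ Qx; first by exists (fun=> Q).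
  have [Q' [hQ' Q'x Q'Q]] : exists Q', [/\ prime_ideal Q', Q' x & Q' `<` Q].
    apply: contrapT => noQ'; apply: nomin; exists Q; split=> // Q' hQ' Q'x Q'Q.
    by apply: contrapT => QQ'; apply: noQ'; exists Q'.
  by apply: prime_chain_extend Q'Q hQ; exact: IH.
by have := dmax _ _ (chain d.+1 P hP Px); rewrite ltnn.
Qed.

(** Chain-free form of height one, suited to domains, where zero is a prime ideal. *)
Definition height_one P : Prop :=
  [/\ prime_ideal P, P != [set 0] &
      forall Q, prime_ideal Q -> Q `<` P -> Q = [set 0]].

Hypothesis domA : is_domain A.

Lemma prime_set0 : prime_ideal [set (0 : A)].
Proof.
split; [exact: ideal_set0|by case: domA|].
by move=> x y /domA.2.
Qed.

Lemma set0_proper P : prime_ideal P -> P != [set 0] -> [set 0] `<` P.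
Proof.
move=> [hP _ _] P0; split=> [_ ->|P0']; first exact: ideal0.
by move/eqP: P0; apply; apply/seteqP; split=> // _ ->; exact: ideal0.
Qed.

Lemma has_height1P P : has_height P 1 <-> height_one P.
Proof.
split=> [[[p [pprime pinc <-]] hmax]|[hP P0 Pmin]].
  have hP : prime_ideal (p 1) by exact: pprime.
  split=> // [|Q hQ QP].
    apply/eqP => p10; have [p01] := pinc 0%N isT; apply; rewrite p10 => _ ->.
    by apply: ideal0; case: (pprime 0%N isT).
  apply: contrapT => /eqP Q0; suff /hmax : prime_chain (p 1) 2 by [].
  apply: (prime_chain_extend (Q := Q)) => //.
  apply: (prime_chain_extend (Q := [set 0])) => //; last exact: set0_proper.
  by exists (fun=> [set 0]); split=> // i _; exact: prime_set0.
split.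
  apply: (prime_chain_extend (Q := [set 0])) => //; last exact: set0_proper.
  by exists (fun=> [set 0]); split=> // i _; exact: prime_set0.
move=> [//|[//|k]] [p [pprime pinc pk]].
have Q0 := Pmin (p k.+1) (pprime k.+1 (leqnSn _)).
rewrite -pk in Q0; have /Q0 {}Q0 := pinc k.+1 (ltnSn _).
have [_] := pinc k (leqnSn _); rewrite Q0 => h; exfalso; apply: h => _ ->.
by apply: ideal0; case: (pprime k (ltnW (leqnSn _))).
Qed.

Lemma minimal_over_height_one P x : noetherian A ->
  x != 0 -> minimal_over P x -> height_one P.
Proof.
move=> noethA x0 Pmin; have [hP Px _] := Pmin; split=> //.
  by apply/eqP => P0; move: Px; rewrite P0 => /eqP; rewrite (negbTE x0).
by move=> Q hQ QP; exact: (krull_principal noethA domA Pmin hQ QP).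
Qed.

Lemma height_one_minimal_over P x : x != 0 -> height_one P -> P x ->
  minimal_over P x.
Proof.
move=> x0 [hP P0 Pmin] Px; split=> // Q hQ Qx QP.
apply: contrapT => PQ; have Q0 : Q = [set 0] by apply: Pmin.
by move: Qx; rewrite Q0 => /eqP; rewrite (negbTE x0).
Qed.

(** Such a [P] is minimal over [x], hence a colon ideal of the ideal generated by [x]. *)
Lemma height_one_Ass P x : noetherian A -> x != 0 -> height_one P -> P x ->
  Ass_ht (quo [set x]) 1 P.
Proof.
move=> noethA x0 hP Px; have Pmin := height_one_minimal_over x0 hP Px.
have [hP' _ _] := Pmin; split; last exact/has_height1P.
apply/AssP; split=> //; apply: (minimal_over_colon noethA _ Pmin).
- exact: ideal_gen_ideal.
- exact: sub_gen_smallest.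
- by apply: ideal_gen_sub => [|_ ->]; first by case: hP'.
Qed.

Lemma height_one_inj P Q : height_one P -> height_one Q -> P `<=` Q -> P = Q.
Proof.
move=> [hP P0 _] [hQ _ Qmin] PQ; apply/seteqP; split=> //.
apply: contrapT => QP; move/eqP: P0; apply; exact: Qmin.
Qed.

(** Distinct height one primes are incomparable, so each [Q] in [s] has an element outside [P]; [w]
    is a product of such elements. *)
Lemma height_one_avoid_inter P s : height_one P ->
  {in s, forall Q, height_one Q} -> P \notin s ->
  exists2 w, ~ P w & {in s, forall Q, Q w}.
Proof.
move=> hP; elim: s => [|Q s IH] hs Ps.
  by exists 1; first by case: hP => -[].
move: Ps; rewrite inE negb_or => /andP[PQ Ps].
have [R Rs|w Pw ws] := IH _ Ps; first by apply: hs; rewrite inE Rs orbT.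
have hQ : height_one Q by apply: hs; rewrite mem_head.
have /existsNP [q /not_implyP [Qq Pq]] : ~ (Q `<=` P).
  by move=> /(height_one_inj hQ hP) QP; rewrite QP eqxx in PQ.
have [[hP' _ PM] _ _] := hP.
exists (q * w); first by case/PM.
move=> R; rewrite inE => /predU1P[->|Rs].
  by case: hQ => -[hQ' _ _] _ _; exact: ideal_mulr.
have /hs [[hR _ _] _ _] : R \in Q :: s by rewrite inE Rs orbT.
by apply: ideal_mull => //; exact: ws.
Qed.

(** Prime avoidance inside a coset of the square of [m], so that an [a] of order one keeps its
    order. *)
Lemma height_one_avoid m a s : is_ideal m ->
  {in s, forall P, height_one P /\ ~ (m `<=` P)} ->
  exists2 z, ideal_pow m 2 z & {in s, forall P, ~ P (a + z)}.
Proof.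
move=> hm; elim: s => [|P s IH] hs; first by exists 0; first exact: ideal_pow_0.
have [Q Qs|z z2 zs] := IH; first by apply: hs; rewrite inE Qs orbT.
have [Paz|Paz] := pselect (P (a + z)); last first.
  by exists z => // Q; rewrite inE => /predU1P[->|/zs].
have [hP /existsNP [u /not_implyP [mu Pu]]] : height_one P /\ ~ (m `<=` P).
  by apply: hs; rewrite mem_head.
have hs1 : {in s, forall Q, height_one Q}.
  move=> Q Qs; have [] // : height_one Q /\ ~ (m `<=` Q).
  by apply: hs; rewrite inE Qs orbT.
have [|w Pw ws] := height_one_avoid_inter hP hs1.
  by apply/negP => /zs.
have [[hP' _ PM] _ _] := hP.
(* The new term is outside [P], which contains [a + z], and inside the primes of [s], which miss
   [a + z]. Squaring [u] puts it in the second power of [m]. *)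
exists (z + w * u ^+ 2).
  apply: idealD (ideal_pow_ideal _ _) z2 _.
  by apply: ideal_mull (ideal_pow_ideal _ _) _; exact: ideal_pow_expn.
move=> Q; rewrite inE addrA => /predU1P[->|Qs].
  move=> /(ideal_addr hP' Paz) /PM [//|].
  by move=> /(@prime_ideal_expn _ _ _ 2); case: hP => hP'' _ _ /(_ hP'').
have [[hQ _ _] _ _] := hs1 Q Qs.
by move=> /(ideal_addl hQ (ideal_mulr _ hQ (ws Q Qs))); exact: zs.
Qed.

End HeightOne.

(** * Elements of order n contained in n height one primes *)

Section HeightOneOfProducts.
Variables (A : comUnitRingType) (m : set A) (d : nat).
Hypotheses (noethA : noetherian A) (localA : local_ring m).
Hypotheses (dimA : has_krull_dim A d) (d_ge2 : (2 <= d)%N).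
Hypothesis grA : is_domain (assoc_gr m).

Let domA : is_domain A := gr_domain_domain noethA localA grA.
Let hm : is_ideal m := m_ideal localA.

(** In a chain of length [d], the term [p 2] lies in [m] and can be replaced by it. *)
Lemma m_height_gt1 : prime_chain m 2.
Proof.
have [[_ [p [pprime pinc _]]] _] := dimA.
have p2m : p 2 `<=` m by apply: (prime_sub_m noethA localA); exact: pprime.
have [p12 p21] : p 1%N `<` p 2%N by exact: pinc.
apply: (prime_chain_extend (Q := p 1%N)); last exact: m_prime.
  exists p; split=> // i hi; first by apply: pprime; exact: leq_trans hi (ltnW d_ge2).
  by apply: pinc; exact: leq_trans hi (ltnW d_ge2).
split; first exact: subset_trans p12 p2m.
by move=> mp1; apply: p21; exact: subset_trans p2m mp1.
Qed.

Lemma height_one_not_m P : height_one P -> ~ (m `<=` P).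
Proof.
move=> hP mP; have Pm : P = m.
  apply/seteqP; split=> //; apply: (prime_sub_m noethA localA).
  by case: hP.
rewrite Pm in hP; have [_ hmax] := (has_height1P domA m).2 hP.
by have := hmax _ m_height_gt1.
Qed.

(** Otherwise [m] lies in all its powers, so it is zero by Krull's intersection theorem, against the
    chain of primes below it. *)
Lemma exists_order1 : exists a, ideal_pow m 1 a /\ ~ ideal_pow m 2 a.
Proof.
apply: contrapT => no; have m12 : ideal_pow m 1 `<=` ideal_pow m 2.
  by move=> a ma; apply: contrapT => na; apply: no; exists a.
have mpow n : m `<=` ideal_pow m n.
  elim: n => // -[|n] IH; first by rewrite ideal_pow1.
  apply: (@subset_trans _ (ideal_pow m 2)); first by rewrite -{1}(ideal_pow1 hm).
  apply: ideal_gen_sub => [|_ [x mx [y my <-]]]; first exact: ideal_pow_ideal.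
  apply: sub_gen_smallest; exists x => //; exists y => //; apply: IH.
  by rewrite -(ideal_pow1 hm).
have [p [pprime pinc p2]] := m_height_gt1.
have [_] := pinc 1%N isT; rewrite p2; apply => x mx.
have -> : x = 0 by apply: (krull_intersection noethA localA) => n; exact: mpow.
by apply: ideal0; case: (pprime 1%N isT).
Qed.

Lemma exists_many_height_one n : exists x (s : seq (set A)),
  [/\ ideal_pow m n x, ~ ideal_pow m n.+1 x, uniq s, size s = n
    & {in s, forall P, height_one P /\ P x}].
Proof.
elim: n => [|n [x [s [mx nmx us ss hs]]]].
  exists 1, [::]; split=> //; rewrite ideal_pow1 //.
  by case: (maximal_m localA).
have [a [a1 a2]] := exists_order1.
have [|z z2 zs] := @height_one_avoid _ m a s hm.
  by move=> P /hs [hP _]; split=> //; exact: height_one_not_m.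
have y1 : ideal_pow m 1 (a + z).
  by apply: idealD (ideal_pow_ideal _ _) a1 _; exact: ideal_powS.
have y2 : ~ ideal_pow m 2 (a + z).
  by move=> /(ideal_addl (ideal_pow_ideal _ _) z2).
have [|P Pmin] := @minimal_over_exists _ d m (a + z) dimA (m_prime noethA localA).
  by rewrite -(ideal_pow1 hm).
have hP := minimal_over_height_one domA noethA (notin_ideal_pow_neq0 y2) Pmin.
have Py : P (a + z) by case: Pmin.
exists ((a + z) * x), (P :: s); split=> /=.
- exact: ideal_pow_mul y1 mx.
- exact: (gr_domain_mul_notin grA y1 y2 mx nmx).
(* [P] is new: it contains [a + z], which the primes of [s] miss. *)
- by rewrite us andbT; apply/negP => /zs.
- by rewrite ss.
- move=> Q; rewrite inE => /predU1P[->|/hs [hQ Qx]]; split=> //.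
    by case: hP => -[hP' _ _] _ _; exact: ideal_mulr.
  by case: (hQ) => -[hQ' _ _] _ _; exact: ideal_mull.
Qed.

End HeightOneOfProducts.

(** * Unique factorization *)

Section UniqueFactorization.
Variable A : comUnitRingType.
Hypothesis ufdA : is_UFD A.

Let domA : is_domain A.
Proof. by case: ufdA. Qed.

(** Uniqueness matches [p], up to a unit, with a factor in [s] or [t]. *)
Lemma irreducible_dvd_prod (p : A) (s t : seq A) : irreducible_elt p ->
  {in s, forall q, irreducible_elt q} -> {in t, forall q, irreducible_elt q} ->
  (exists c, \prod_(q <- s) q * \prod_(q <- t) q = p * c) ->
  exists2 q, q \in s ++ t & exists r, q = r * p.
Proof.
move=> irrp irrs irrt [c stE]; have [_ fact uniq] := ufdA.
have irrst : {in s ++ t, forall q, irreducible_elt q}.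
  by move=> q; rewrite mem_cat => /orP[/irrs|/irrt].
have st0 : p * c != 0.
  rewrite -stE -big_cat; apply/eqP; elim: (s ++ t) irrst => [|q l IH] hl.
    by rewrite big_nil => /eqP; rewrite oner_eq0.
  rewrite big_cons => /domA.2 [/eqP|].
    by have [/negbTE -> _ _] := hl q (mem_head _ _).
  by apply: IH => r rl; apply: hl; rewrite inE rl orbT.
(* It is enough to factor [p * c] with a multiple of [p] at the head: uniqueness then pairs index 0
   with a factor of the other product. *)
suff [p' [l [irrl lE [r p'E]]]] : exists p' l,
    [/\ {in p' :: l, forall q, irreducible_elt q},
        \prod_(q <- p' :: l) q = p * c & exists r, p' = r * p].
  have [|t' tt' [sz /(_ 0%N isT) [u _ uE]]] := uniq _ _ irrl irrst.
    by rewrite lE -stE big_cat.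
  exists t'`_0; last by exists (u * r); rewrite uE /= p'E mulrA.
  by rewrite (perm_mem tt') mem_nth // -sz.
(* A unit [c] has no factorization to append, so it is absorbed into [p]. *)
have [cu|cnu] := boolP (c \is a GRing.unit).
  exists (p * c), [::]; split; last by exists c; rewrite mulrC.
    move=> q; rewrite inE => /eqP ->; have [p0 pu pirr] := irrp; split=> //.
      by rewrite unitrMl.
    move=> a b abE; have /pirr [->|] : p = a * (b / c).
    - by rewrite mulrA -abE mulrK.
    - by left.
    - by rewrite unitrMl ?unitrV //; right.
  by rewrite big_seq1.
have c0 : c != 0 by apply: contraNneq st0 => ->; rewrite mulr0.
have [l irrl cE] := fact c c0 cnu.
exists p, l; split; last by exists 1; rewrite mul1r.
  by move=> q; rewrite inE => /predU1P[->|/irrl].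
by rewrite big_cons cE.
Qed.

(** The factor [u] lets units be treated together with nonunits. *)
Lemma ufd_factorization (x : A) : x != 0 -> exists u s,
  [/\ u \is a GRing.unit, {in s, forall p, irreducible_elt p}
    & x = u * \prod_(p <- s) p].
Proof.
move=> x0; have [xu|xu] := boolP (x \is a GRing.unit).
  by exists x, [::]; split=> //; rewrite big_nil mulr1.
have [_ fact _] := ufdA; have [s irrs xE] := fact x x0 xu.
by exists 1, s; split=> //; [exact: unitr1|rewrite mul1r].
Qed.

Lemma irreducible_prime (p : A) :
  irreducible_elt p -> prime_ideal (ideal_gen [set p]).
Proof.
move=> irrp; split; first exact: ideal_gen_ideal.
  move=> /ideal_gen1P [r r1]; have [_ /negP + _] := irrp; apply.
  by apply/unitrPr; exists r; rewrite mulrC.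
move=> x y /ideal_gen1P [c xyE].
have gen0 z : z = 0 -> ideal_gen [set p] z.
  by move=> ->; apply/ideal_gen1P; exists 0; rewrite mul0r.
have [x0|/ufd_factorization [u [s [uu irrs xE]]]] := eqVneq x 0.
  by left; exact: gen0.
have [y0|/ufd_factorization [v [t [vu irrt yE]]]] := eqVneq y 0.
  by right; exact: gen0.
have dvd (w q r : A) (l : seq A) : q \in l -> q = r * p ->
    ideal_gen [set p] (w * \prod_(i <- l) i).
  move=> ql qE; apply/ideal_gen1P; exists (w * r * \prod_(i <- rem q l) i).
  by rewrite (big_rem q) //= qE; ring.
have [|q] := irreducible_dvd_prod irrp irrs irrt.
  (* The units of both factorizations are moved to the cofactor of [p]. *)
  exists (u^-1 * v^-1 * c); apply: (mulrI uu); apply: (mulrI vu).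
  transitivity (x * y); first by rewrite xE yE; ring.
  rewrite xyE; transitivity (c * p * (u / u) * (v / v)); last by ring.
  by rewrite !divrr ?mulr1.
rewrite mem_cat => /orP[qs|qt] [r qE].
  by left; rewrite xE; exact: dvd qE.
by right; rewrite yE; exact: dvd qE.
Qed.

End UniqueFactorization.

(** * Counting associated primes and bounding alpha *)

Lemma le_counting (R : realType) (T : choiceType) (S : set T) (s : seq T) :
  uniq s -> [set` s] `<=` S -> ((size s)%:R%:E <= counting S :> \bar R)%E.
Proof.
move=> us sS; rewrite /counting; case: ifPn => [/asboolP finS|_]; last exact: leey.
rewrite lee_fin ler_nat; apply: uniq_leq_size => // x xs.
by rewrite in_fset_set // inE; exact: sS.
Qed.

Lemma counting_le (R : realType) (T : choiceType) (S : set T) (s : seq T) :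
  S `<=` [set` s] -> (counting S <= (size s)%:R%:E :> \bar R)%E.
Proof.
move=> Ss; have finS : finite_set S by apply: sub_finite_set Ss _; exact: finite_seq.
rewrite /counting asboolT // lee_fin ler_nat; apply: uniq_leq_size.
  exact: finmap.fset_uniq.
by move=> x; rewrite in_fset_set // inE => /Ss.
Qed.

Section Alpha.
Variables (R : realType) (A : comUnitRingType) (m : set A).
Hypotheses (noethA : noetherian A) (localA : local_ring m).
Hypothesis grA : is_domain (assoc_gr m).

Let domA : is_domain A := gr_domain_domain noethA localA grA.
Let hm : is_ideal m := m_ideal localA.

Lemma alpha_at_ge d s : has_krull_dim A d -> (2 <= d)%N ->
  (s%:R%:E <= alpha_at R m s)%E.
Proof.
move=> dimA d_ge2.
have [x [l [mx nmx ul ls hl]]] :=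
  exists_many_height_one noethA localA dimA d_ge2 grA s.
have x0 := notin_ideal_pow_neq0 nmx.
apply: le_trans (ereal_sup_ubound _); first last.
  exists x; last reflexivity; split=> //.
  by move=> a b; rewrite ![x * _]mulrC; exact: domain_mulIf.
rewrite -ls; apply: le_counting => // P /hl [hP Px].
exact: height_one_Ass.
Qed.

Lemma alpha_at_le s : (0 < s)%N -> is_UFD A -> (alpha_at R m s <= s%:R%:E)%E.
Proof.
move=> s0 ufdA; apply: ge_ereal_sup => _ [x [mx nmx _] <-].
have x0 := notin_ideal_pow_neq0 nmx; have [_ fact _] := ufdA.
(* As [s] is positive, [x] is a nonunit and has irreducible factors. *)
have xm : m x by rewrite -(ideal_pow1 hm); exact: ideal_pow_le mx.
have [l irrl xE] := fact x x0 (m_nonunit localA xm).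
have lm : {in l, forall p, m p}.
  move=> p /irrl [_ /negP pu _]; apply: contrapT => /(notin_m_unit noethA localA).
  exact: pu.
have ls : (size l <= s)%N.
  (* All factors lie in [m], so more than [s] of them would push [x] into the power [s.+1]. *)
  rewrite leqNgt; apply/negP => sl; apply: nmx; apply: ideal_pow_le sl _ _.
  by rewrite xE; exact: ideal_pow_prod.
apply: (@le_trans _ _ (size l)%:R%:E); last by rewrite lee_fin ler_nat.
rewrite -(size_map (fun p => ideal_gen [set p])); apply: counting_le.
move=> P [/AssP [hP [u Pu]] /(has_height1P domA) [_ _ Pmin]] /=.
have Px : P x.
  by rewrite Pu; apply: (sub_colon _ (ideal_gen_ideal _)); exact: sub_gen_smallest.
rewrite xE in Px; have [p pl Pp] := prime_ideal_prod hP Px.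
suff -> : P = ideal_gen [set p] by exact: map_f.
have [p0 _ _] := irrl p pl.
have pP : ideal_gen [set p] `<=` P.
  by apply: ideal_gen_sub => [|_ ->]; first by case: hP.
(* A strict inclusion would make the prime generated by [p] zero, as [P] has height one. *)
apply/seteqP; split=> //; apply: contrapT => Pnp.
have pE := Pmin _ (irreducible_prime ufdA (irrl p pl)) (conj pP Pnp).
move/eqP: p0; apply; have : ideal_gen [set p] p by exact: sub_gen_smallest.
by rewrite pE.
Qed.

End Alpha.

(** Only positive indices are bounded: at 0 the inverse of [s] takes the default value 0. Every tail
    contains a positive index. *)
Lemma limn_esup_ge (R : realType) (u : (\bar R)^nat) (l : \bar R) :
  (forall n, (0 < n)%N -> (l <= u n)%E) -> (l <= limn_esup u)%E.
Proof.
move=> lu; rewrite limn_esup_lim; apply: lime_ge; first exact: is_cvg_esups.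
apply: nearW => n; apply: le_trans (lu n.+1 isT) _.
by apply: ereal_sup_ubound; exists n.+1 => //=; exact: leqnSn.
Qed.

Lemma limn_esup_le (R : realType) (u : (\bar R)^nat) (l : \bar R) :
  (forall n, (0 < n)%N -> (u n <= l)%E) -> (limn_esup u <= l)%E.
Proof.
move=> ul; rewrite limn_esup_lim; apply: lime_le; first exact: is_cvg_esups.
exists 1%N => // n /= n1; apply: ge_ereal_sup => _ [k /= nk <-].
by apply: ul; exact: leq_trans nk.
Qed.

Theorem proposition2p2 (R : realType) (A : comUnitRingType) (m : set A) (d : nat)
  (A_noetherian : noetherian A) (A_local : local_ring m)
  (A_dim : has_krull_dim A d) (d_ge2 : (2 <= d)%N)
  (residue_infinite : infinite_set [set: quo m])
  (gr_domain : is_domain (assoc_gr m)) :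
  (1%:E <= alpha R m)%E /\ (is_UFD A -> alpha R m = 1%:E).
Proof.
have ge1 : (1%:E <= alpha R m)%E.
  apply: limn_esup_ge => n n0.
  rewrite lee_pdivlMr ?ltr0n // mul1e.
  exact: alpha_at_ge A_dim d_ge2.
split=> // ufdA; apply/eqP; rewrite eq_le ge1 andbT.
apply: limn_esup_le => n n0; rewrite lee_pdivrMr ?ltr0n // mul1e.
exact: alpha_at_le.
Qed.
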